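(* Let $G=\left\{\begin{pmatrix} a&b\\0&a^{-1}\end{pmatrix}: a>0,\ b\in\mathbb R\right\}$. There are three classes of crossed homomorphisms with respect to the conjugation action on $G$, that is, the crossed homomorphisms with respect to the conjugation action on $G$ are exactly the following maps: $$D\begin{pmatrix} a&b\\0&a^{-1}\end{pmatrix}=\begin{pmatrix}1&\mu ab+\frac{\lambda}{2}(a^2-1)\\0&1\end{pmatrix},\qquad \mu,\lambda\in\mathbb R,$$ $$\tilde D\begin{pmatrix} a&b\\0&a^{-1}\end{pmatrix}=\begin{pmatrix}a^{-1}&-b+qa\ln a\\0&a\end{pmatrix},\qquad q\in\mathbb R,$$ and $$\bar D\begin{pmatrix} a&b\\0&a^{-1}\end{pmatrix}=\begin{pmatrix}a^{p}&q\frac{a^{2+p}-a^{-p}}{2(p+1)}-ba^{1+p}\\0&a^{-p}\end{pmatrix},\qquad p,q\in\mathbb R,\ p\ne0,-1.$$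
   Context: A crossed homomorphism with respect to the conjugation action on a Lie group $G$ is a smooth map $D:G\to G$ satisfying $D(xy)=D(x)\,x\,D(y)\,x^{-1}$ for all $x,y\in G$. *)

(* Defs.v *)
From HB Require Import structures.
From mathcomp Require Import all_boot all_order all_algebra.
From mathcomp Require Import all_classical all_reals all_analysis.

Set Implicit Arguments.
Unset Strict Implicit.
Unset Printing Implicit Defensive.

Import Order.TTheory GRing.Theory Num.Theory.
Import numFieldNormedType.Exports.

Local Open Scope classical_set_scope.
Local Open Scope ring_scope.

Section Smooth.
Variables (R : realType) (V W : normedModType R).

(* For finite-dimensional V, the differential of f is of class C^n on an open
   set U iff all the directional derivatives 'D_v f are, so [Cn_on n U f] is
   then the usual notion of a function of class C^n on U.  Only meant for
   open U. *)
Fixpoint Cn_on (n : nat) (U : set V) (f : V -> W) : Prop :=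
  if n is m.+1 then
    (forall x, U x -> differentiable f x) /\ (forall v, Cn_on m U ('D_v f))
  else forall x, U x -> {for x, continuous f}.

Definition smooth_on (U : set V) (f : V -> W) : Prop := forall n, Cn_on n U f.

End Smooth.

Section UpperTriangularGroup.
Variable R : realType.

(* The matrix with rows (a, b) and (c, d). *)
Definition mx22 (a b c d : R) : 'M[R]_2 :=
  \matrix_(i, j) if i == 0 then (if j == 0 then a else b)
                 else (if j == 0 then c else d).

Definition is_upmx : pred 'M[R]_2 :=
  fun A => (0 < A 0 0) && (A == mx22 (A 0 0) (A 0 1) 0 (A 0 0)^-1).

Record upgroup := Upgroup { upval :> 'M[R]_2 ; _ : is_upmx upval }.

HB.instance Definition _ := [isSub for upval].
HB.instance Definition _ := [Choice of upgroup by <:].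

Fact upmx_subproof (a b : R) : 0 < a -> is_upmx (mx22 a b 0 a^-1).
Proof. by move=> a0; rewrite /is_upmx !mxE /= a0 eqxx. Qed.

Definition upmx (a b : R) (a0 : 0 < a) : upgroup :=
  Upgroup (upmx_subproof b a0).

Lemma up00_gt0 (x : upgroup) : 0 < upval x 0 0.
Proof. by case: x => A /= /andP[]. Qed.

Lemma upvalE (x : upgroup) :
  upval x = mx22 (upval x 0 0) (upval x 0 1) 0 (upval x 0 0)^-1.
Proof. by case: x => A /= /andP[_ /eqP]. Qed.

Lemma mul_mx22 (a b c d a' b' c' d' : R) :
  mx22 a b c d *m mx22 a' b' c' d' =
  mx22 (a * a' + b * c') (a * b' + b * d') (c * a' + d * c') (c * b' + d * d').
Proof.
apply/matrixP => i j; rewrite !mxE !big_ord_recl big_ord0 !mxE /= addr0.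
by case: ifP => _; case: ifP.
Qed.

Lemma mx22_1 : mx22 1 0 0 1 = 1%:M.
Proof.
by apply/matrixP => i j; rewrite !mxE; case: i => [[|[|]]]//; case: j => [[|[|]]].
Qed.

Fact is_upmx_mul (x y : upgroup) : is_upmx (upval x *m upval y).
Proof.
rewrite (upvalE x) (upvalE y) mul_mx22 !(mulr0, mul0r, addr0, add0r) -invfM.
by rewrite upmx_subproof// mulr_gt0// up00_gt0.
Qed.

Fact is_upmx_1 : is_upmx 1%:M.
Proof. by rewrite -mx22_1 -[X in mx22 _ _ _ X]invr1 upmx_subproof. Qed.

Fact mx22_inv (x : upgroup) :
  let B := mx22 (upval x 0 0)^-1 (- upval x 0 1) 0 (upval x 0 0) in
  upval x *m B = 1%:M.
Proof.
have a0 : upval x 0 0 != 0 by rewrite gt_eqF// up00_gt0.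
rewrite /= {1}(upvalE x) mul_mx22 !(mulr0, mul0r, addr0, add0r).
by rewrite mulfV// mulVf// mulrN mulrC addNr mx22_1.
Qed.

Fact up_unitmx (x : upgroup) : upval x \in unitmx.
Proof. by have [] := mulmx1_unit (mx22_inv x). Qed.

Fact is_upmx_inv (x : upgroup) : is_upmx (invmx (upval x)).
Proof.
suff -> : invmx (upval x) =
    mx22 (upval x 0 0)^-1 (- upval x 0 1) 0 (upval x 0 0).
  rewrite -[X in mx22 _ _ _ X]invrK upmx_subproof//.
  by rewrite invr_gt0 up00_gt0.
by rewrite -[LHS]mulmx1 -(mx22_inv x) mulmxA mulVmx ?mul1mx ?up_unitmx.
Qed.

Definition up_mul (x y : upgroup) : upgroup := Upgroup (is_upmx_mul x y).
Definition up_one : upgroup := Upgroup is_upmx_1.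
Definition up_inv (x : upgroup) : upgroup := Upgroup (is_upmx_inv x).

Fact up_mulA : associative up_mul.
Proof. by move=> x y z; apply/val_inj; rewrite /= mulmxA. Qed.
Fact up_mul1 : left_id up_one up_mul.
Proof. by move=> x; apply/val_inj; rewrite /= mul1mx. Qed.
Fact up_mulr1 : right_id up_one up_mul.
Proof. by move=> x; apply/val_inj; rewrite /= mulmx1. Qed.
Fact up_mulV : left_inverse up_one up_inv up_mul.
Proof. by move=> x; apply/val_inj; rewrite /= mulVmx// up_unitmx. Qed.
Fact up_mulrV : right_inverse up_one up_inv up_mul.
Proof. by move=> x; apply/val_inj; rewrite /= mulmxV// up_unitmx. Qed.

HB.instance Definition _ :=
  isGroup.Build upgroup up_mulA up_mul1 up_mulr1 up_mulV up_mulrV.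

(* The global chart (a, b) of the Lie group, a diffeomorphism onto the open
   half-plane a > 0; [up_param] takes the junk value 1 outside of it. *)
Definition up_chart (x : upgroup) : R * R := (upval x 0 0, upval x 0 1).
Definition up_dom : set (R * R) := [set u | 0 < u.1].
Definition up_param (u : R * R) : upgroup :=
  insubd (1%g : upgroup) (mx22 u.1 u.2 0 u.1^-1).

Lemma up_chart_dom (x : upgroup) : up_dom (up_chart x).
Proof. exact: up00_gt0. Qed.

Lemma up_paramE (a b : R) (a0 : 0 < a) : up_param (a, b) = upmx b a0.
Proof. by apply/val_inj; rewrite val_insubd /= upmx_subproof. Qed.

Lemma up_chartK : cancel up_chart up_param.
Proof.
move=> x; rewrite (up_paramE _ (up00_gt0 x)).
by apply/val_inj; rewrite /= -upvalE.
Qed.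

Lemma up_paramK (u : R * R) : up_dom u -> up_chart (up_param u) = u.
Proof.
by case: u => a b a0; rewrite (up_paramE _ a0) /up_chart /= !mxE.
Qed.

Definition up_smooth (D : upgroup -> upgroup) : Prop :=
  smooth_on up_dom (fun u : R * R => up_chart (D (up_param u)) : R * R).

Definition conj_crossed_hom (D : upgroup -> upgroup) : Prop :=
  up_smooth D /\ (forall x y, D (x * y) = D x * x * D y * x^-1)%g.

End UpperTriangularGroup.

(* Main.v *)
Require Import Defs.
From mathcomp Require Import all_boot all_order all_algebra.
From mathcomp Require Import all_classical all_reals all_analysis.
From mathcomp Require Import ring lra.
Import Order.TTheory GRing.Theory Num.Theory.
Import numFieldNormedType.Exports.
Local Open Scope classical_set_scope.
Local Open Scope ring_scope.

(** The substitution phi x = D x * x turns the identity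
    D (x * y) = D x * x * D y * x^-1 into phi (x * y) = phi x * phi y
    ([crossed_homP]).  Multiplication by x is smooth and invertible, so the
    crossed homomorphisms correspond to the smooth endomorphisms of the group,
    and the three families of the theorem are the three families of
    endomorphisms in [standard_endo], read through D x = phi x * x^-1.

    For an endomorphism phi, write x as a unipotent matrix times a diagonal
    matrix; phi is determined by its restrictions to these two one-parameter
    subgroups.  The diagonal part of phi kills the unipotents, since a unipotent
    matrix is conjugate to its own square, and on the diagonal matrices it is a
    character a |-> a ^ s.  On the unipotents the corner entry of phi is additive
    and differentiable, hence b |-> m b.  Conjugating the unipotents by diagonal
    matrices gives m a ^ 2 = m a ^ (2 s) for all a > 0, so that m = 0 unless s = 1.
    Let B t be the corner of the image of the diagonal matrix diag t with
    entries e ^ t and e ^ (- t).  It satisfies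
    B (t + t') = e ^ (s t) B t' + e ^ (- s t') B t, whose left-hand side is
    symmetric in t and t'.  Comparing the two right-hand sides at t' = 1 gives
    B t = c (e ^ (s t) - e ^ (- s t)) when s <> 0; when s = 0, B is additive,
    hence linear.  The cases s = 1, s = 0 and the others are the three families
    ([morph_standard_endo]).

    The additive functions met on the way are linear because an additive map
    differentiable at 0 is its own differential
    ([additive_differentiable_diff]).  The converse also requires the maps of the
    list to be smooth.  In the chart their entries are built by sums and products
    from b, ln a and the real powers of a; this class of functions is closed
    under directional derivatives on the half-plane a > 0, which forces all its
    members to be smooth ([smooth_on_class], [elementary_smooth]). *)

(** * Differentiable functions *)

Lemma near_eq_differentiable {K : numFieldType} {V W : normedModType K}
    (f g : V -> W) (x : V) :
  {near x, f =1 g} -> differentiable f x -> differentiable g x.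
Proof.
move=> fg /diff_locallyP[dc /eqaddoP df].
have gE : g \o shift x = cst (g x) + 'd f x +o_ (0 : V) id.
  apply/eqaddoP => _/posnumP[e].
  have fg0 : \forall h \near (0 : V), f (h + x) = g (h + x).
    by rewrite (near_shift x)/=; near do rewrite /= sub0r addrNK//.
  near=> h.
  have -> : (g \o shift x - (cst (g x) + 'd f x)) h =
            (f \o shift x - (cst (f x) + 'd f x)) h.
    by rewrite /= !fctE /= (nbhs_singleton fg) (near fg0 h).
  by near: h; exact: df.
by apply/diff_locallyP; rewrite (diff_unique dc gE).
Unshelve. all: by end_near. Qed.

(** The difference quotient of an additive f at 0 in the direction x equals f x
    along the steps 1 / (n + 1), so f x is the directional derivative. *)
Lemma additive_differentiable_diff {K : archiRealFieldType} {V W : normedModType K}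
    (f : V -> W) :
  {morph f : x y / x + y} -> differentiable f 0 -> f =1 'd f 0.
Proof.
move=> fD df x.
have f0 : f 0 = 0 by apply: (addrI (f 0)); rewrite -fD !addr0.
have fMn n y : f (y *+ n) = f y *+ n.
  by elim: n => [|n IH]; rewrite ?mulr0n // !mulrS fD IH.
rewrite -deriveE //; apply/esym/cvg_lim => //.
have /cvg_ex[/= l fl] := diff_derivable (v := x) df.
suff -> : f x = l by [].
have h0 : harmonic n @[n --> \oo] --> (0 : K)^'.
  move=> A [e /= e0 eA]; have /cvgrPdist_lt/(_ _ e0)[N _ hN] := @cvg_harmonic K.
  exists N => // n /= Nn; apply: eA; last by rewrite gt_eqF ?harmonic_gt0.
  by have := hN n Nn.
have hE n : (harmonic n)^-1 *: ((f \o shift 0) (harmonic n *: x) - f 0) = f x :> W.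
  rewrite /= addr0 f0 subr0 invrK scaler_nat -fMn -scaler_nat scalerA.
  by rewrite mulfV ?scale1r// pnatr_eq0.
have := cvg_comp _ _ h0 fl; rewrite [X in X @ _ --> _](_ : _ = cst (f x)).
  move=> cl; apply/esym/(@cvg_unique _ _ (cst (f x) @ \oo)) => //; last exact: cvg_cst.
by apply/funext => n; rewrite -[RHS](hE n).
Qed.

(** * Smooth functions on an open set *)

(** Needed because the value of a function outside U is arbitrary, while
    derivatives on U are computed from a formula valid on U only. *)
Lemma Cn_on_eq {R : realType} {V W : normedModType R} (U : set V) (n : nat)
    (f g : V -> W) :
  open U -> {in U, f =1 g} -> Cn_on n U f -> Cn_on n U g.
Proof.
move=> oU; have near_fg (f' g' : V -> W) x : {in U, f' =1 g'} -> U x ->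
    {near x, f' =1 g'}.
  move=> fg Ux; have nU : nbhs x U by exact: open_nbhs_nbhs.
  by near=> y; apply: fg; apply/mem_set; near: y.
elim: n f g => [|n IH] f g fg /=.
  move=> cf x Ux; rewrite /prop_for /continuous_at.
  rewrite -(fg x (mem_set Ux)).
  apply: cvg_trans (cf x Ux); apply: near_eq_cvg.
  exact: (near_fg f g x fg Ux).
move=> [df Df]; split=> [x Ux|v].
  by apply: near_eq_differentiable (df x Ux); exact: near_fg.
apply: IH (Df v) => x /set_mem Ux.
by apply: near_eq_derive; exact: (near_fg f g).
Unshelve. all: by end_near. Qed.

(** Smoothness is coinductive: a class of differentiable functions containing the
    directional derivatives of its members consists of smooth functions.  The
    induction is on the order of differentiability, for all members at once. *)
Lemma smooth_on_class {R : realType} {V W : normedModType R} (U : set V)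
    (S : (V -> W) -> Prop) :
  open U ->
  (forall f, S f -> (forall x, U x -> differentiable f x) /\
     forall v, exists2 g, S g & {in U, 'D_v f =1 g}) ->
  forall f, S f -> smooth_on U f.
Proof.
move=> oU stable f Sf n; elim: n f Sf => [|n IH] f /stable[df Df] /=.
  by move=> x Ux; exact/differentiable_continuous/df.
split=> // v; have [g Sg gE] := Df v.
by apply: Cn_on_eq (IH g Sg) => // x Ux; rewrite gE.
Qed.

Section HalfPlane.
Context {R : realType}.
Implicit Types (f g : R * R -> R) (u v : R * R).

(** The functions of (a, b) from which the entries of the crossed homomorphisms
    are built.  The coordinate a itself is the power a ^ 1, so that the derivatives
    of a ^ r and of ln a are again products of generators. *)
Inductive elementary : (R * R -> R) -> Prop :=
| elementary_cst c : elementary (fun=> c)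
| elementary_snd : elementary snd
| elementary_ln : elementary (fun u => ln u.1)
| elementary_powR r : elementary (fun u => u.1 `^ r)
| elementaryD f g : elementary f -> elementary g ->
    elementary (fun u => f u + g u)
| elementaryM f g : elementary f -> elementary g ->
    elementary (fun u => f u * g u).

Lemma open_up_dom : open (@up_dom R).
Proof.
have -> : @up_dom R = fst @^-1` [set x | 0 < x] by [].
by apply: open_comp; [move=> u _; exact: cvg_fst|exact: open_gt].
Qed.

Lemma is_diff_fst u : is_diff u (fst : R * R -> R) fst.
Proof.
have cfst : continuous (fst : {linear (R * R)%type -> R}) by move=> w; exact: cvg_fst.
by apply: DiffDef; [exact: linear_differentiable|rewrite diff_lin].
Qed.

Lemma is_diff_snd u : is_diff u (snd : R * R -> R) snd.
Proof.
have csnd : continuous (snd : {linear (R * R)%type -> R}) by move=> w; exact: cvg_snd.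
by apply: DiffDef; [exact: linear_differentiable|rewrite diff_lin].
Qed.

Lemma derive_comp_fst (h : R -> R) (dh : R) u v : is_derive u.1 1 h dh ->
  differentiable (h \o fst) u /\ 'D_v (h \o fst) u = v.1 * dh.
Proof.
move=> [/derivable1_diffP dfh dhE]; have [dfst fstE] := is_diff_fst u.
have dc := differentiable_comp dfst dfh; split=> //.
by rewrite deriveE// diff_comp//= fstE diff1E//= derive1E dhE.
Qed.

Lemma elementary_derive f : elementary f ->
  (forall u, up_dom u -> differentiable f u) /\
  forall v, exists2 g, elementary g & {in @up_dom R, 'D_v f =1 g}.
Proof.
elim => {f} [c||| r |f g ef [df Df] eg [dg Dg]|f g ef [df Df] eg [dg Dg]].
- split=> [u _|v]; first exact: differentiable_cst.
  exists (fun=> 0); first exact: elementary_cst.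
  by move=> u _; rewrite derive_cst.
- split=> [u _|v]; first exact: (@ex_diff _ _ _ _ _ _ _ (is_diff_snd u)).
  exists (fun=> v.2); first exact: elementary_cst.
  by move=> u _; have [d dE] := is_diff_snd u; rewrite deriveE// dE.
- split=> [u u0|v]; first by case: (derive_comp_fst _ _ _ 0 (is_derive1_ln u0)).
  exists (fun u => v.1 * u.1 `^ (-1)).
    by apply: elementaryM; [exact: elementary_cst|exact: elementary_powR].
  move=> u /set_mem u0; rewrite powR_inv1 ?ltW//.
  by case: (derive_comp_fst _ _ _ v (is_derive1_ln u0)).
- split=> [u u0|v]; first by case: (derive_comp_fst _ _ _ 0 (is_derive1_powR r u0)).
  exists (fun u => v.1 * (r * u.1 `^ (r - 1))).
    by do ![apply: elementaryM|exact: elementary_cst|exact: elementary_powR].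
  by move=> u /set_mem u0; case: (derive_comp_fst _ _ _ v (is_derive1_powR r u0)).
- split=> [u u0|v]; first by apply: differentiableD; [exact: df|exact: dg].
  have [[f' ef' f'E] [g' eg' g'E]] := (Df v, Dg v).
  exists (fun u => f' u + g' u); first exact: elementaryD.
  move=> u uU; have u0 := set_mem uU; rewrite -f'E// -g'E//.
  by rewrite -deriveD//; apply: diff_derivable; [exact: df|exact: dg].
- split=> [u u0|v]; first by apply: differentiableM; [exact: df|exact: dg].
  have [[f' ef' f'E] [g' eg' g'E]] := (Df v, Dg v).
  exists (fun u => f u * g' u + g u * f' u).
    by apply: elementaryD; exact: elementaryM.
  move=> u uU; have u0 := set_mem uU; rewrite -f'E// -g'E//.
  by rewrite [LHS]deriveM//; apply: diff_derivable; [exact: df|exact: dg].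
Qed.

(** The class to iterate on consists of the pairs of elementary functions,
    the directional derivative of a pair being taken componentwise. *)
Lemma elementary_smooth f g : elementary f -> elementary g ->
  smooth_on (@up_dom R) (fun u => (f u, g u) : R * R).
Proof.
move=> ef eg.
apply: (@smooth_on_class _ _ _ (@up_dom R) (fun F => exists f' g' : R * R -> R,
  [/\ elementary f', elementary g' & F = fun u => (f' u, g' u)])); last first.
- by exists f, g.
- move=> F [{}f [{}g [{}ef {}eg ->]]].
  have [[df Df] [dg Dg]] := (elementary_derive _ ef, elementary_derive _ eg).
  split=> [u u0|v]; first by apply: differentiable_pair; [exact: df|exact: dg].
  have [[f' ef' f'E] [g' eg' g'E]] := (Df v, Dg v).
  exists (fun u => (f' u, g' u)); first by exists f', g'.
  move=> u uU; have u0 := set_mem uU; rewrite -f'E// -g'E//.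
  have [dfu dgu] := (df u u0, dg u u0).
  by rewrite !deriveE//; [rewrite diff_pair|exact: differentiable_pair].
- exact: open_up_dom.
Qed.

End HalfPlane.

(** * The group in coordinates *)

Section Coordinates.
Context {R : realType}.
Implicit Types (x y : upgroup R) (a b s t : R).

Definition ul x : R := upval x 0 0.
Definition ur x : R := upval x 0 1.

Lemma ul_gt0 x : 0 < ul x. Proof. exact: up00_gt0. Qed.

Lemma ul_neq0 x : ul x != 0. Proof. by rewrite gt_eqF ?ul_gt0. Qed.

Lemma ul_upmx a b (a0 : 0 < a) : ul (upmx b a0) = a.
Proof. by rewrite /ul !mxE. Qed.

Lemma ur_upmx a b (a0 : 0 < a) : ur (upmx b a0) = b.
Proof. by rewrite /ur !mxE. Qed.

Lemma upval_mx22P x a b :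
  upval x = mx22 a b 0 a^-1 <-> ul x = a /\ ur x = b.
Proof.
split=> [xE|[<- <-]]; last exact: upvalE.
by rewrite /ul /ur xE !mxE.
Qed.

Lemma up_ext x y : ul x = ul y -> ur x = ur y -> x = y.
Proof.
by move=> ulE urE; apply/val_inj; rewrite /= (upvalE x); apply/esym/upval_mx22P.
Qed.

Lemma upmxK x : upmx (ur x) (ul_gt0 x) = x.
Proof. by apply: up_ext; rewrite ?ul_upmx ?ur_upmx. Qed.

Let upvalM x y : upval (x * y)%g = mx22 (ul x * ul y)
  (ul x * ur y + ur x / ul y) 0 (ul x * ul y)^-1.
Proof.
rewrite /= (upvalE x) (upvalE y) mul_mx22 !(mulr0, mul0r, addr0, add0r).
by rewrite -invfM.
Qed.

Lemma ulM x y : ul (x * y)%g = ul x * ul y.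
Proof. by have /upval_mx22P[] := upvalM x y. Qed.

Lemma urM x y : ur (x * y)%g = ul x * ur y + ur x / ul y.
Proof. by have /upval_mx22P[] := upvalM x y. Qed.

Lemma ul_up_param (u : R * R) : up_dom u -> ul (up_param u) = u.1.
Proof. by move=> u0; rewrite -[in RHS](up_paramK u0). Qed.

Lemma ur_up_param (u : R * R) : up_dom u -> ur (up_param u) = u.2.
Proof. by move=> u0; rewrite -[in RHS](up_paramK u0). Qed.

(** The logarithmic parameter makes [diag] a one-parameter subgroup. *)
Definition diag t : upgroup R := upmx 0 (expR_gt0 t).
Definition unip b : upgroup R := upmx b ltr01.

Definition coordE := (ulM, urM, ul_upmx, ur_upmx).

Lemma diagD s t : diag (s + t) = (diag s * diag t)%g.
Proof. by apply: up_ext; rewrite !coordE ?expRD// mulr0 mul0r addr0. Qed.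

Lemma unipD b c : unip (b + c) = (unip b * unip c)%g.
Proof. by apply: up_ext; rewrite !coordE ?mulr1// invr1 mulr1 mul1r addrC. Qed.

(** Conjugation by diag t multiplies the corner of a unipotent matrix by
    e ^ (2 t): this ties the action of an endomorphism on the unipotents to its
    action on the diagonal matrices. *)
Lemma diag_unip t b : (diag t * unip b = unip (expR t ^+ 2 * b) * diag t)%g.
Proof.
apply: up_ext; rewrite !coordE ?mulr1 ?mul1r// mul0r addr0 add0r.
by rewrite expr2 mulrAC mulfK// expR_eq0.
Qed.

Lemma unip_diagE x : x = (unip (ul x * ur x) * diag (ln (ul x)))%g.
Proof.
have x0 := ul_neq0 x; apply: up_ext; rewrite !coordE lnK ?posrE ?ul_gt0 ?mul1r//.
by rewrite add0r mulrAC mulfV// mul1r.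
Qed.

End Coordinates.

(** * Endomorphisms of the group *)

Section Endomorphisms.
Context {R : realType}.
Implicit Types (phi : upgroup R -> upgroup R) (x y : upgroup R).

(** The cases are s = 1, s = 0 and the other s, for the character a |-> a ^ s of
    the diagonal part.  For s = 1 the unipotents may have a nontrivial image,
    which is what m measures; for s = 0 the function a ^ s - a ^ (- s)
    degenerates to the logarithm. *)
Definition standard_endo phi : Prop :=
  [\/ exists m c : R, forall x, ul (phi x) = ul x /\
        ur (phi x) = m * ur x + c * (ul x - (ul x)^-1),
      exists q : R, forall x, ul (phi x) = 1 /\ ur (phi x) = q * ln (ul x)
    | exists s c : R, [/\ s != 0, s != 1 & forall x, ul (phi x) = ul x `^ s /\
        ur (phi x) = c * (ul x `^ s - ul x `^ (- s))]].

Lemma standard_endo_morph phi : standard_endo phi -> {morph phi : x y / (x * y)%g}.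
Proof.
move=> [[m [c E]]|[q E]|[s [c [_ _ E]]]] x y;
  have [ux uy] := (ul_gt0 x, ul_gt0 y); have [nx ny] := (ul_neq0 x, ul_neq0 y);
  apply: up_ext; rewrite ?ulM ?urM;
  rewrite ?(E x).1 ?(E x).2 ?(E y).1 ?(E y).2 ?(E (x * y)%g).1 ?(E (x * y)%g).2;
  rewrite ?ulM ?urM ?mulr1 //.
- by field; rewrite nx ny.
- by rewrite lnM ?posrE// invr1 mulr1 mul1r mulrDr addrC.
- by rewrite powRM// ltW.
- have [sx sy] : ul y `^ s != 0 /\ ul x `^ s != 0.
    by rewrite !gt_eqF ?powR_gt0.
  by rewrite !powRN powRM ?ltW//; field; rewrite sx sy.
Qed.

(** Differentiability of the two entries at the identity suffices: phi is then
    differentiable along both one-parameter subgroups, and the functional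
    equations propagate this information to the whole group. *)
Lemma morph_standard_endo phi : {morph phi : x y / (x * y)%g} ->
  differentiable (fun u : R * R => ul (phi (up_param u)) : R) ((1, 0) : R * R) ->
  differentiable (fun u : R * R => ur (phi (up_param u)) : R) ((1, 0) : R * R) ->
  standard_endo phi.
Proof.
move=> phiM dul dur.
pose A t := ul (phi (diag t)); pose B t := ur (phi (diag t)).
pose f b := ur (phi (unip b)).
have diagE (t : R) : diag t = up_param (expR t, 0) by exact/esym/up_paramE.
have unipE (b : R) : unip b = up_param (1, b) by exact/esym/up_paramE.
have along_diag (g : R * R -> R) : differentiable g ((1, 0) : R * R) ->
    differentiable (g \o (fun t : R => (expR t, 0) : R * R)) 0.
  move=> dg; apply: differentiable_comp; last by rewrite expR0.
  apply: differentiable_pair; last exact: differentiable_cst.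
  exact/derivable1_diffP/derivable_expR.
have dA : differentiable A 0.
  have -> : A = (fun u => ul (phi (up_param u))) \o (fun t => (expR t, 0)).
    by apply/funext => t; rewrite /A diagE.
  exact: along_diag.
have dB : differentiable B 0.
  have -> : B = (fun u => ur (phi (up_param u))) \o (fun t => (expR t, 0)).
    by apply/funext => t; rewrite /B diagE.
  exact: along_diag.
have df : differentiable f 0.
  have d_unip : differentiable (fun b : R => (1, b) : R * R) 0.
    exact: differentiable_pair.
  have -> : f = (fun u => ur (phi (up_param u))) \o (fun b => (1, b)).
    by apply/funext => b; rewrite /f unipE.
  exact: (differentiable_comp d_unip dur).
have linear_of (g : R -> R) : {morph g : x y / x + y} -> differentiable g 0 ->
    forall t, g t = g 1 * t.
  move=> gD dg t; have gE := additive_differentiable_diff g gD dg.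
  by rewrite !gE -[in LHS](mulr1 t) linearZ /= mulrC.
have A_gt0 t : 0 < A t by exact: ul_gt0.
have A0 t : A t != 0 by exact: ul_neq0.
have AD t t' : A (t + t') = A t * A t' by rewrite /A diagD phiM ulM.
have BD t t' : B (t + t') = A t * B t' + B t / A t' by rewrite /B diagD phiM urM.
(* ln A is additive. *)
have [s AE] : exists s, forall t, A t = expR (s * t).
  exists (ln (A 1)) => t; rewrite -(linear_of (@ln R \o A)) /= ?lnK ?posrE//.
    by move=> t1 t2; rewrite /= AD lnM ?posrE.
  apply: differentiable_comp => //; apply/derivable1_diffP.
  by case: (is_derive1_ln (A_gt0 0)).
have ul_unip b : ul (phi (unip b)) = 1.
  have /(congr1 (ul \o phi)) /= := diag_unip (ln 2 / 2) b.
  rewrite !phiM !ulM mulrC => /(mulIf (A0 _)).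
  (* The parameter ln 2 / 2 makes unip b conjugate to unip (2 b), its square. *)
  rewrite -expRM_natr divfK ?pnatr_eq0// lnK ?posrE ?ltr0n//.
  rewrite mulr_natl mulr2n unipD phiM ulM -[LHS]mulr1.
  by move=> /(mulfI (ul_neq0 _))/esym.
have fD : {morph f : b c / b + c}.
  by move=> b c; rewrite /f unipD phiM urM !ul_unip invr1 mulr1 mul1r addrC.
pose m := f 1; have fE b : f b = m * b by exact: linear_of.
(* Apply phi to [diag_unip] and compare the corners. *)
have mA t : m * expR t ^+ 2 = m * A t ^+ 2.
  have /(congr1 (ur \o phi)) /= := diag_unip t 1.
  rewrite mulr1 !phiM !urM !ul_unip -/(f _) -/(f _) -/(A t) -/(B t) !fE.
  rewrite invr1 !mulr1 mul1r addrC => /addrI mE.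
  by rewrite -[LHS](divfK (A0 t)) -mE; ring.
(* B (t + 1) = B (1 + t), expanded on both sides. *)
have BE t : (A 1 - (A 1)^-1) * B t = B 1 * (A t - (A t)^-1).
  have /eqP := BD t 1; rewrite [t + 1]addrC BD -subr_eq0 => /eqP BE.
  by apply/eqP; rewrite -subr_eq0 -BE; apply/eqP; ring.
have phiE x : ul (phi x) = A (ln (ul x)) /\
    ur (phi x) = B (ln (ul x)) + m * (ul x * ur x) / A (ln (ul x)).
  have /(congr1 phi) -> := unip_diagE x.
  by rewrite phiM ulM urM !ul_unip !mul1r -fE.
have AlnE x : A (ln (ul x)) = ul x `^ s.
  by rewrite AE /powR (negbTE (ul_neq0 x)).
have ur_phi x : s != 0 -> let c := B 1 / (A 1 - (A 1)^-1) in
    ur (phi x) = c * (ul x `^ s - ul x `^ (- s)) + m * (ul x * ur x) / ul x `^ s.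
  move=> s0 /=; have A1 : A 1 - (A 1)^-1 != 0.
    rewrite subr_eq0 AE mulr1 -expRN; apply: contraNneq s0 => /expR_inj sE.
    by apply/eqP; lra.
  rewrite (phiE x).2 AlnE powRN; congr (_ + _).
  by apply: (mulfI A1); rewrite BE AlnE mulrA [X in _ = X * _]mulrC divfK.
(* At t = 1, mA reads m e ^ 2 = m e ^ (2 s). *)
have m0 : s != 1 -> m = 0.
  move=> s1; apply: contraNeq s1 => m0; have := mA 1; move/(mulfI m0).
  by rewrite AE -!expRM_natr => /expR_inj sE; apply/eqP; lra.
have [s0|s0] := eqVneq s 0.
  constructor 2; exists (B 1) => x.
  rewrite (phiE x).1 (phiE x).2 AlnE s0 powRr0 invr1 mulr1.
  rewrite m0 ?mul0r ?addr0 ?s0 1?eq_sym ?oner_eq0//; split=> //.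
  apply: linear_of => // t t'.
  by rewrite BD !AE s0 !mul0r expR0 invr1 mulr1 mul1r addrC.
have [s1|s1] := eqVneq s 1.
  constructor 1; exists m, (B 1 / (A 1 - (A 1)^-1)) => x.
  have x0 := ul_neq0 x.
  rewrite (phiE x).1 ur_phi// AlnE s1 powRN !powRr1 ?ltW ?ul_gt0//; split=> //.
  by rewrite addrC [ul x * ur x]mulrC mulrA mulfK.
constructor 3; exists s, (B 1 / (A 1 - (A 1)^-1)); split=> // x.
by rewrite (phiE x).1 ur_phi// AlnE m0// !mul0r addr0.
Qed.

(** For [standard_endo_smooth]: smoothness of the listed maps reduces to that of
    elementary functions. *)
Lemma standard_endo_elementary phi : standard_endo phi ->
  exists f g, [/\ elementary f, elementary g &
    forall x, ul (phi x) = f (up_chart x) /\ ur (phi x) = g (up_chart x)].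
Proof.
have ec := @elementary_cst R; have ep := @elementary_powR R.
have e2 := @elementary_snd R; have el := @elementary_ln R.
move=> [[m [c E]]|[q E]|[s [c [_ _ E]]]].
- exists (fun u => u.1 `^ 1), (fun u => m * u.2 + c * (u.1 `^ 1 + (-1) * u.1 `^ (-1))).
  split=> // [|x]; first by do ![done|apply: elementaryD|apply: elementaryM].
  by rewrite (E x).1 (E x).2 mulN1r powR_inv1 ?powRr1 ?ltW//; exact: ul_gt0.
- exists (fun=> 1), (fun u => q * ln u.1).
  by split=> //; exact: elementaryM.
- exists (fun u => u.1 `^ s), (fun u => c * (u.1 `^ s + (-1) * u.1 `^ (- s))).
  split=> // [|x]; last by rewrite (E x).1 (E x).2 mulN1r.
  by apply: elementaryM => //; apply: elementaryD => //; exact: elementaryM.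
Qed.

End Endomorphisms.

(** * Crossed homomorphisms *)

(** In phi (x * y) = D (x * y) * x * y, the factor x^-1 ending the formula for
    D (x * y) cancels against x. *)
Lemma crossed_homP (G : groupType) (D : G -> G) :
  (forall x y, D (x * y) = D x * x * D y * x^-1)%g <->
  {morph (fun x => D x * x)%g : x y / (x * y)%g}.
Proof.
split=> [DM x y|DM x y].
  by rewrite /= DM !mulgA mulgVK.
by apply: (@mulIg _ (x * y)%g); rewrite DM !mulgA mulgVK.
Qed.

Section CrossedHomomorphisms.
Context {R : realType}.
Implicit Types (D : upgroup R -> upgroup R).

(** Right multiplication by x is a rational map in the chart, with denominator
    a <> 0; the formulas hold on the half-plane, a neighbourhood of (1, 0). *)
Lemma smooth_endo_differentiable D : up_smooth D ->
  differentiable (fun u : R * R => ul (D (up_param u) * up_param u)%g : R)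
    ((1, 0) : R * R) /\
  differentiable (fun u : R * R => ur (D (up_param u) * up_param u)%g : R)
    ((1, 0) : R * R).
Proof.
move=> /(_ 1%N)[/(_ (1, 0) ltr01)] => dF _.
have near_dom : \forall u \near ((1, 0) : R * R), @up_dom R u.
  by apply: open_nbhs_nbhs; split; [exact: open_up_dom|exact: ltr01].
have [d1 _] := is_diff_fst ((1, 0) : R * R).
have [d2 _] := is_diff_snd ((1, 0) : R * R).
have dF1 := differentiable_comp dF (@ex_diff _ _ _ _ _ _ _ (is_diff_fst _)).
have dF2 := differentiable_comp dF (@ex_diff _ _ _ _ _ _ _ (is_diff_snd _)).
split.
- apply: near_eq_differentiable (differentiableM dF1 d1).
  by near=> u; rewrite ulM ul_up_param//; near: u.
- have d1V : differentiable (fun u : R * R => u.1^-1) ((1, 0) : R * R).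
    by apply: differentiableV => //=; exact: oner_neq0.
  apply: near_eq_differentiable
    (differentiableD (differentiableM dF1 d2) (differentiableM dF2 d1V)).
  by near=> u; rewrite urM ul_up_param ?ur_up_param//; near: u.
Unshelve. all: by end_near. Qed.

(** Recover D from phi by D x = phi x * x^-1: its entries are A / a and
    a B - b A, where A and B are those of phi. *)
Lemma standard_endo_smooth D :
  standard_endo (fun x => D x * x)%g -> up_smooth D.
Proof.
move=> /standard_endo_elementary[f [g [ef eg fgE]]].
have ef' : elementary (fun u => f u * u.1 `^ (-1)).
  by apply: elementaryM => //; exact: elementary_powR.
have eg' : elementary (fun u => u.1 `^ 1 * g u + (-1) * (f u * u.2)).
  have e2 := @elementary_snd R; have e1 := elementary_cst (-1 : R).
  by apply: elementaryD; do !apply: elementaryM => //; exact: elementary_powR.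
move=> n; apply: Cn_on_eq (elementary_smooth _ _ ef' eg' n); first exact: open_up_dom.
move=> u /set_mem u0; rewrite powR_inv1 ?powRr1 ?ltW//.
have [] := fgE (up_param u); rewrite up_paramK// ulM urM.
rewrite ul_up_param// ur_up_param// => <- <-.
rewrite /up_chart -/(ul _) -/(ur _).
have u1 : u.1 != 0 by rewrite gt_eqF.
by congr (_, _); field.
Qed.

Lemma conj_crossed_homP D :
  conj_crossed_hom D <-> standard_endo (fun x => D x * x)%g.
Proof.
split=> [[sD /crossed_homP DM]|E].
  by have [] := smooth_endo_differentiable _ sD; exact: morph_standard_endo.
split; first exact: standard_endo_smooth.
by apply/crossed_homP; exact: standard_endo_morph.
Qed.

(** The dictionary between the entries A, B of phi and the matrix of
    D x = phi x * x^-1, used once for each family. *)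
Lemma endo_entriesP D (A B : R -> R -> R) :
  (forall x, ul (D x * x)%g = A (ul x) (ur x) /\
             ur (D x * x)%g = B (ul x) (ur x)) <->
  (forall (a b : R) (a0 : 0 < a), upval (D (upmx b a0)) =
     mx22 (A a b / a) (a * B a b - b * A a b) 0 (A a b / a)^-1).
Proof.
split=> [E a b a0|E x].
  have [] := E (upmx b a0); rewrite ulM urM ul_upmx ur_upmx => <- <-.
  have an0 : a != 0 by rewrite gt_eqF.
  by apply/upval_mx22P; split; field.
have /upval_mx22P[] := E _ (ur x) (ul_gt0 x); rewrite upmxK => ulE urE.
have x0 := ul_neq0 x.
by rewrite ulM urM ulE urE; split; field.
Qed.

End CrossedHomomorphisms.

Theorem proposition4p1 (R : realType) (D : upgroup R -> upgroup R) :
  conj_crossed_hom D <->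
  [\/ exists mu lambda : R, forall (a b : R) (a0 : 0 < a),
        upval (D (upmx b a0)) =
          mx22 1 (mu * a * b + lambda / 2 * (a ^+ 2 - 1))
               0 1,
      exists q : R, forall (a b : R) (a0 : 0 < a),
        upval (D (upmx b a0)) =
          mx22 a^-1 (- b + q * a * ln a)
               0    a
    | exists p q : R, [/\ p != 0, p != -1 &
        forall (a b : R) (a0 : 0 < a),
        upval (D (upmx b a0)) =
          mx22 (a `^ p) (q * ((a `^ (2 + p) - a `^ (- p)) / (2 * (p + 1)))
                           - b * a `^ (1 + p))
               0        (a `^ (- p))]].
Proof.
apply: iff_trans (conj_crossed_homP D) _.
(* Each of the next three facts translates one family; the parameters
   correspond by mu = m - 1 and lambda = 2 c, then q = q, then p = s - 1 and
   q = 2 (p + 1) c. *)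
have form1 m c : (forall x, ul (D x * x)%g = ul x /\
      ur (D x * x)%g = m * ur x + c * (ul x - (ul x)^-1)) <->
    forall (a b : R) (a0 : 0 < a), upval (D (upmx b a0)) =
      mx22 1 ((m - 1) * a * b + (2 * c) / 2 * (a ^+ 2 - 1)) 0 1.
  apply: iff_trans (endo_entriesP D (fun a _ => a)
    (fun a b => m * b + c * (a - a^-1))) _.
  suff E a b : 0 < a -> mx22 (a / a) (a * (m * b + c * (a - a^-1)) - b * a) 0
      (a / a)^-1 = mx22 1 ((m - 1) * a * b + (2 * c) / 2 * (a ^+ 2 - 1)) 0 1.
    by split=> DE a b a0; rewrite DE E.
  move=> a0; have an0 : a != 0 by rewrite gt_eqF.
  by rewrite divff// invr1; congr mx22; field.
have form2 q : (forall x, ul (D x * x)%g = 1 /\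
      ur (D x * x)%g = q * ln (ul x)) <->
    forall (a b : R) (a0 : 0 < a), upval (D (upmx b a0)) =
      mx22 a^-1 (- b + q * a * ln a) 0 a.
  apply: iff_trans (endo_entriesP D (fun _ _ => 1) (fun a _ => q * ln a)) _.
  suff E a b : mx22 (1 / a) (a * (q * ln a) - b * 1) 0 (1 / a)^-1 =
      mx22 a^-1 (- b + q * a * ln a) 0 a.
    by split=> DE a b a0; rewrite DE E.
  by rewrite div1r invrK; congr mx22; ring.
have form3 p c : p + 1 != 0 -> (forall x, ul (D x * x)%g = ul x `^ (p + 1) /\
      ur (D x * x)%g = c * (ul x `^ (p + 1) - ul x `^ (- (p + 1)))) <->
    forall (a b : R) (a0 : 0 < a), upval (D (upmx b a0)) =
      mx22 (a `^ p) (2 * (p + 1) * c * ((a `^ (2 + p) - a `^ (- p)) / (2 * (p + 1)))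
                       - b * a `^ (1 + p)) 0 (a `^ (- p)).
  move=> p1; apply: iff_trans (endo_entriesP D (fun a _ => a `^ (p + 1))
    (fun a _ => c * (a `^ (p + 1) - a `^ (- (p + 1))))) _.
  suff E a b : 0 < a -> mx22 (a `^ (p + 1) / a)
      (a * (c * (a `^ (p + 1) - a `^ (- (p + 1)))) - b * a `^ (p + 1)) 0
      (a `^ (p + 1) / a)^-1 =
      mx22 (a `^ p) (2 * (p + 1) * c * ((a `^ (2 + p) - a `^ (- p)) / (2 * (p + 1)))
                       - b * a `^ (1 + p)) 0 (a `^ (- p)).
    by split=> DE a b a0; rewrite DE E.
  move=> a0; have an0 : a != 0 by rewrite gt_eqF.
  have ap0 : a `^ p != 0 by rewrite gt_eqF ?powR_gt0.
  have addE r s : a `^ (r + s) = a `^ r * a `^ s by rewrite powRD ?an0 ?implybT.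
  have a1E : a `^ 1 = a by rewrite powRr1 ?ltW.
  have -> : 2 + p = p + 1 + 1 by ring.
  rewrite [1 + p]addrC !powRN !addE a1E mulfK//; congr mx22.
  by field; rewrite ap0 an0 p1.
split=> [[[m [c /form1 E]]|[q /form2 E]|[s [c [s0 s1 E]]]]|
         [[mu [l E]]|[q /form2 E]|[p [q [p0 p1 E]]]]].
- by constructor 1; exists (m - 1), (2 * c).
- by constructor 2; exists q.
- have sE : s - 1 + 1 = s by rewrite subrK.
  constructor 3; exists (s - 1), (2 * (s - 1 + 1) * c); split.
  + by rewrite subr_eq0.
  + by rewrite -subr_eq0 opprK sE.
  + by apply/form3; rewrite sE.
- constructor 1; exists (mu + 1), (l / 2); apply/form1 => a b a0.
  by rewrite E; congr mx22; field.
- by constructor 2; exists q.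
- have p1' : p + 1 != 0 by rewrite -[1]opprK subr_eq0.
  constructor 3; exists (p + 1), (q / (2 * (p + 1))); split=> //.
  + by rewrite -subr_eq0 addrK.
  + apply/form3 => // a b a0; rewrite E; congr mx22.
    by field.
Qed.
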